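(* Let $(\Psi_1,\Psi_2,\eta,\widetilde\eta)$ be a classical travelling wave, i.e. a classical solution of $$\begin{cases}\Delta\Psi_i=g\,y\,\rho_i'(-\Psi_i)-\beta_i(\Psi_i) & \text{in }\Omega_i,\ i=1,2,\\ \frac{|\nabla\Psi_2|^2}{2}+g\rho_2(-\Psi_2)(y+d)=Q_2 & \text{on } y=\eta(x),\\ \frac{|\nabla\Psi_1|^2-|\nabla\Psi_2|^2}{2}+g\big(\rho_1(-\Psi_1)-\rho_2(-\Psi_2)\big)(y+d)=Q_1 & \text{on } y=\widetilde\eta(x),\\ \Psi_1=\Psi_2=0 & \text{on } y=\widetilde\eta(x),\\ \Psi_1=-p_1 & \text{on } y=-d,\\ \Psi_2=-p_2 & \text{on } y=\eta(x),\end{cases}$$ and put $\omega_i=\Delta\Psi_i$. If the surface $\eta$ and the interface $\widetilde\eta$ are unperturbed (that is, only perturbations with $\eta_p=\widetilde\eta_p=0$ are considered) and $\partial_{22}F_i(y,\omega_i)<0$ for $i=1,2$, then the travelling wave is linearly stable, i.e. the quadratic form $\delta^2H$ is nonnegative for all such perturbations.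
   Context: Fix $g>0$, $d>0$ and real constants $Q_1,Q_2,p_1,p_2$. All functions of $x$ are $2\pi$-periodic in $x$; $\eta,\widetilde\eta$ are $C^2$ with $-d<\widetilde\eta(x)<\eta(x)$, $\Omega_1=\{-\pi<x<\pi,\ -d<y<\widetilde\eta(x)\}$, $\Omega_2=\{-\pi<x<\pi,\ \widetilde\eta(x)<y<\eta(x)\}$, and $\Psi_i$ is $C^2$ up to the boundary of $\Omega_i$. The functions $\rho_i,\beta_i$ ($i=1,2$) are given sufficiently smooth functions of one real variable with $\rho_i'\le0$, $\beta_i'<0$ and $\rho_1>\rho_2$. The functions $F_i(y,\cdot)$ are $C^2$ on $\mathbb R$ with nowhere vanishing second derivative, and are defined (up to an additive function of $y$) by $(\partial_2F_i(y,\cdot))^{-1}(p)=g y\rho_i'(p)-\beta_i(-p)$ for $p\in\mathbb R$ (the right-hand side being assumed invertible in $p$). $F_i$ is a $C^2$ function, and $\partial_2F_i$, $\partial_{22}F_i$ denote the first and second partial derivatives in the second variable. The functional is $$H(\Psi_1,\Psi_2,\eta,\widetilde\eta)=\iint_{\Omega_1}\Big[\frac{|\nabla\Psi_1|^2}{2}+g\rho_1(p_1)(y+d)-(Q_1+Q_2)-F_1(y,\Delta\Psi_1)\Big]dy\,dx+\iint_{\Omega_2}\Big[\frac{|\nabla\Psi_2|^2}{2}+g\rho_2(0)(y+d)-Q_2-F_2(y,\Delta\Psi_2)\Big]dy\,dx .$$ Perturbations $(\Psi_{1p},\Psi_{2p},\eta_p,\widetilde\eta_p)$ are quadruples of $C^2$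 functions (up to the boundary), $2\pi$-periodic in $x$. The quadratic form $\delta^2H$ is the second variation of $H$ at the travelling wave with both variations equal to $(\Psi_{1p},\Psi_{2p},\eta_p,\widetilde\eta_p)$, i.e. the second derivative at $\epsilon=0$ of $H(\Psi_1+\epsilon\Psi_{1p},\Psi_2+\epsilon\Psi_{2p},\eta+\epsilon\eta_p,\widetilde\eta+\epsilon\widetilde\eta_p)$. The travelling wave is called linearly stable if $\delta^2H\ge0$ for all perturbations under consideration. *)

(* Defs.v *)
From mathcomp Require Import all_boot all_order all_algebra.
From mathcomp Require Import all_classical all_reals all_analysis.

Set Implicit Arguments.
Unset Strict Implicit.
Unset Printing Implicit Defensive.

Import Order.TTheory GRing.Theory Num.Theory.
Import numFieldNormedType.Exports.

Local Open Scope classical_set_scope.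
Local Open Scope ring_scope.

(* A point p of the plane has abscissa x = p.1 and ordinate y = p.2; the
   partial derivatives of a function of two variables are the library's
   directional derivatives along the two vectors below. *)
Definition e_x (R : realType) : R * R := (1, 0).
Definition e_y (R : realType) : R * R := (0, 1).
Arguments e_x {R}.
Arguments e_y {R}.

Definition axis (R : realType) (v : R * R) : Prop := v = e_x \/ v = e_y.

Definition gradsq (R : realType) (u : R * R -> R) (p : R * R) : R :=
  ('D_e_x u p) ^+ 2 + ('D_e_y u p) ^+ 2.

Definition laplacian (R : realType) (u : R * R -> R) (p : R * R) : R :=
  'D_e_x ('D_e_x u) p + 'D_e_y ('D_e_y u) p.

Definition extends_to_closure (R : realType) (D : set (R * R))
    (f : R * R -> R) : Prop :=
  exists fbar : R * R -> R,
    {within closure D, continuous fbar} /\ forall p, D p -> fbar p = f p.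

(* D is meant to be open.  The values of u outside closure D are irrelevant,
   so the derivatives of the total function u are only constrained in D. *)
Definition C2_up_to_boundary (R : realType) (D : set (R * R))
    (u : R * R -> R) : Prop :=
  [/\ {within closure D, continuous u},
      forall v, axis v ->
        (forall p, D p -> derivable u p v) /\ extends_to_closure D ('D_v u) &
      forall v w, axis v -> axis w ->
        (forall p, D p -> derivable ('D_v u) p w) /\
        extends_to_closure D ('D_w ('D_v u))].

(* Boundary value at p of a function f defined in D: the limit of f(q) as q
   tends to p inside D. *)
Definition trace (R : realType) (D : set (R * R)) (f : R * R -> R)
    (p : R * R) : R :=
  lim (f @ within D (nbhs p)).

Definition Ck (R : realType) (k : nat) (f : R -> R) : Prop :=
  (forall j x, (j < k)%N -> derivable (derive1n j f) x 1) /\ continuous (derive1n k f).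

(* Used for waves and for perturbations alike. *)
Record state (R : realType) := State {
  Psi1 : R * R -> R;
  Psi2 : R * R -> R;
  eta : R -> R;
  etat : R -> R
}.

Record setting (R : realType) := Setting {
  grav : R;
  depth : R;
  Q1 : R;
  Q2 : R;
  p1 : R;
  p2 : R;
  rho1 : R -> R;
  rho2 : R -> R;
  beta1 : R -> R;
  beta2 : R -> R
}.

Definition admissible_setting (R : realType) (c : setting R) : Prop :=
  [/\ 0 < grav c /\ 0 < depth c,
      Ck 2 (rho1 c) /\ Ck 2 (rho2 c),
      Ck 1 (beta1 c) /\ Ck 1 (beta2 c),
      (forall s, derive1 (rho1 c) s <= 0) /\ (forall s, derive1 (rho2 c) s <= 0) &
      [/\ forall s, derive1 (beta1 c) s < 0,
          forall s, derive1 (beta2 c) s < 0 &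
          forall s, rho2 c s < rho1 c s]].

(* The two layers, unbounded in x, and their period cells Omega_1, Omega_2. *)
Definition layer1 (R : realType) (d : R) (s : state R) : set (R * R) :=
  [set p | - d < p.2 < etat s p.1].
Definition layer2 (R : realType) (s : state R) : set (R * R) :=
  [set p | etat s p.1 < p.2 < eta s p.1].

Definition Omega1 (R : realType) (d : R) (s : state R) : set (R * R) :=
  [set p | - pi < p.1 < pi] `&` layer1 d s.
Definition Omega2 (R : realType) (s : state R) : set (R * R) :=
  [set p | - pi < p.1 < pi] `&` layer2 s.

Definition x_periodic (R : realType) (D : set (R * R))
    (u : R * R -> R) : Prop :=
  forall p, closure D p -> u (p.1 + pi *+ 2, p.2) = u p.

(* Regularity and periodicity of the state h relative to the fluid domain of
   the state s. *)
Definition regular_on (R : realType) (d : R) (s h : state R) : Prop :=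
  [/\ C2_up_to_boundary (layer1 d s) (Psi1 h),
      C2_up_to_boundary (layer2 s) (Psi2 h),
      x_periodic (layer1 d s) (Psi1 h) /\ x_periodic (layer2 s) (Psi2 h),
      Ck 2 (eta h) /\ periodic (eta h) (pi *+ 2) &
      Ck 2 (etat h) /\ periodic (etat h) (pi *+ 2)].

Record travelling_wave (R : realType) (c : setting R) (s : state R) : Prop := {
  tw_regular : regular_on (depth c) s s;
  tw_order : forall x, - depth c < etat s x < eta s x;
  tw_lower : forall p, Omega1 (depth c) s p ->
    laplacian (Psi1 s) p =
    grav c * p.2 * derive1 (rho1 c) (- Psi1 s p) - beta1 c (Psi1 s p);
  tw_upper : forall p, Omega2 s p ->
    laplacian (Psi2 s) p =
    grav c * p.2 * derive1 (rho2 c) (- Psi2 s p) - beta2 c (Psi2 s p);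
  tw_surface_pressure : forall x,
    trace (layer2 s) (gradsq (Psi2 s)) (x, eta s x) / 2 +
    grav c * rho2 c (- Psi2 s (x, eta s x)) * (eta s x + depth c) = Q2 c;
  tw_interface_pressure : forall x,
    (trace (layer1 (depth c) s) (gradsq (Psi1 s)) (x, etat s x) -
     trace (layer2 s) (gradsq (Psi2 s)) (x, etat s x)) / 2 +
    grav c * (rho1 c (- Psi1 s (x, etat s x)) -
              rho2 c (- Psi2 s (x, etat s x))) * (etat s x + depth c) = Q1 c;
  tw_interface : forall x,
    Psi1 s (x, etat s x) = 0 /\ Psi2 s (x, etat s x) = 0;
  tw_bed : forall x, Psi1 s (x, - depth c) = - p1 c;
  tw_surface : forall x, Psi2 s (x, eta s x) = - p2 c
}.

(* F is a function of (y, w), constrained only for the heights y occurring in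
   the layer S: requiring p |-> g y rho'(p) - beta(-p) to be invertible for
   every real y would exclude nonlinear rho. *)
Definition is_F (R : realType) (g : R) (rho beta : R -> R) (S : set (R * R))
    (F : R * R -> R) : Prop :=
  [/\ C2_up_to_boundary [set q | (snd @` S) q.1] F,
      forall y w, (snd @` S) y -> 'D_e_y ('D_e_y F) (y, w) != 0 &
      forall y, (snd @` S) y ->
        let rhs := fun p => g * y * derive1 rho p - beta (- p) in
        let d2F := fun w => 'D_e_y F (y, w) in
        cancel rhs d2F /\ cancel d2F rhs].

Definition area (R : realType) := (@lebesgue_measure R \x @lebesgue_measure R)%E.
Arguments area : clear implicits.

Definition H (R : realType) (c : setting R) (F1 F2 : R * R -> R)
    (s : state R) : R :=
  \int[area R]_(p in Omega1 (depth c) s)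
    (gradsq (Psi1 s) p / 2 + grav c * rho1 c (p1 c) * (p.2 + depth c)
     - (Q1 c + Q2 c) - F1 (p.2, laplacian (Psi1 s) p)) +
  \int[area R]_(p in Omega2 s)
    (gradsq (Psi2 s) p / 2 + grav c * rho2 c 0 * (p.2 + depth c)
     - Q2 c - F2 (p.2, laplacian (Psi2 s) p)).

Definition perturb (R : realType) (s h : state R) (eps : R) : state R :=
  State (fun p => Psi1 s p + eps * Psi1 h p)
        (fun p => Psi2 s p + eps * Psi2 h p)
        (fun x => eta s x + eps * eta h x)
        (fun x => etat s x + eps * etat h x).

Definition second_variation (R : realType) (J : state R -> R)
    (s h : state R) : R :=
  derive1n 2 (fun eps => J (perturb s h eps)) 0.

(* derive1n is total, hence the separate existence requirement. *)
Definition has_second_variation (R : realType) (J : state R -> R)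
    (s h : state R) : Prop :=
  let j := fun eps => J (perturb s h eps) in
  (\forall eps \near 0, derivable j eps 1) /\ derivable (derive1 j) 0 1.

Definition linearly_stable (R : realType) (J : state R -> R) (s : state R)
    (considered : set (state R)) : Prop :=
  forall h, considered h ->
    has_second_variation J s h /\ 0 <= second_variation J s h.

Definition fixed_boundary_perturbations (R : realType) (d : R)
    (s : state R) : set (state R) :=
  [set h | [/\ regular_on d s h,
               forall x, eta h x = 0 & forall x, etat h x = 0]].

(* Main.v *)
Require Import Defs.
From mathcomp Require Import all_boot all_order all_algebra.
From mathcomp Require Import all_classical all_reals all_analysis.
Import Order.TTheory GRing.Theory Num.Theory.
Import numFieldNormedType.Exports.
Local Open Scope classical_set_scope.
Local Open Scope ring_scope.
Set Implicit Arguments.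
Unset Strict Implicit.
Unset Printing Implicit Defensive.

(** When the surface and the interface are not perturbed, the two domains of
    integration do not depend on the parameter t of the perturbation, so H is
    the sum of one energy per layer (layer_energy), each an integral over a
    fixed domain.  In the integrand of a layer with stream function u,
    perturbed to u + t h, the gradient and the laplacian are affine in t:
    writing u_x for 'D_e_x u and Delta for the laplacian, the integrand is
      (u_x + t h_x)^2/2 + (u_y + t h_y)^2/2 + (terms without t)
        - F (y, Delta u + t Delta h),
    and its second derivative at t = 0 is
      h_x^2 + h_y^2 - F_22 (y, Delta u) (Delta h)^2,
    which is nonnegative as soon as F_22 (y, Delta u) < 0.

    What remains is to differentiate twice under the integral sign.  The
    period cell of a layer is a bounded open set, and C^2 regularity up to the
    boundary extends each derivative involved to a continuous function on a
    compact set.  The integrand and its first two t-derivatives are therefore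
    continuous in the point and bounded uniformly in -1 < t < 1 (the notion
    tame below), and bounded convergence applies: this is
    integral_tame_second_derivative.  The result for one layer is
    layer_second_variation_ge0; it is used for the region between the bed and
    the interface and for the region between the interface and the surface. *)

(** * Differentiating twice under the integral sign *)

Lemma bounded_integrable {d} {T : measurableType d} {R : realType}
    (mu : {measure set T -> \bar R}) (B : set T) (f : T -> R) (M : R) :
  measurable B -> (mu B < +oo)%E -> measurable_fun B f ->
  (forall p, B p -> `|f p| <= M) -> mu.-integrable B (EFin \o f).
Proof.
move=> mB muB mf fM; apply: measurable_bounded_integrable => //.
exists M; split; first exact: num_real.
by move=> x Mx p Bp; exact: le_trans (fM p Bp) (ltW Mx).
Qed.

(** Bounded convergence on a set of finite measure.  The parameter is confined
    to ]-1, 1[ because only a neighbourhood of 0 matters; the first derivative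
    is computed on the whole interval, so that it can be differentiated again
    at 0. *)
Lemma second_derivative_under_integral {d} {T : measurableType d}
    {R : realType} (mu : {measure set T -> \bar R}) (B : set T)
    (f f' f'' : R -> T -> R) (M : R) :
  measurable B -> (mu B < +oo)%E ->
  (forall t : R, -1 < t < 1 -> measurable_fun B (f t)) ->
  (forall t : R, -1 < t < 1 -> measurable_fun B (f' t)) ->
  (forall (t : R) p, -1 < t < 1 -> B p ->
     [/\ `|f t p| <= M, `|f' t p| <= M & `|f'' t p| <= M]) ->
  (forall (t : R) p, -1 < t < 1 -> B p -> is_derive t 1 (f ^~ p) (f' t p)) ->
  (forall (t : R) p, -1 < t < 1 -> B p -> is_derive t 1 (f' ^~ p) (f'' t p)) ->
  let J t := \int[mu]_(p in B) f t p in
  [/\ \forall t \near 0, derivable J t 1, derivable (derive1 J) 0 1 &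
      derive1n 2 J 0 = \int[mu]_(p in B) f'' 0 p].
Proof.
move=> mB muB mf mf' fM df df' J.
have under (g g' : R -> T -> R) (t : R) : -1 < t < 1 ->
    (forall t : R, -1 < t < 1 -> measurable_fun B (g t)) ->
    (forall (t : R) p, -1 < t < 1 -> B p -> `|g t p| <= M /\ `|g' t p| <= M) ->
    (forall (t : R) p, -1 < t < 1 -> B p -> is_derive t 1 (g ^~ p) (g' t p)) ->
    derivable (fun t => \int[mu]_(p in B) g t p) t 1 /\
    derive1 (fun t => \int[mu]_(p in B) g t p) t = \int[mu]_(p in B) g' t p.
  move=> t11 mg gM dg.
  have I r : (`](-1), 1[%classic : set R) r = (-1 < r < 1).
    by rewrite /= in_itv.
  have intg r : (`](-1), 1[%classic : set R) r ->
      mu.-integrable B (EFin \o g r).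
    rewrite I => r11; apply: (@bounded_integrable _ _ _ _ _ _ M) => //.
      exact: mg.
    by move=> p Bp; have [] := gM r p r11 Bp.
  have dg1 r p : (`](-1), 1[%classic : set R) r -> B p ->
      derivable (g ^~ p) r 1.
    by rewrite I => r11 Bp; have [] := dg r p r11 Bp.
  have intM : mu.-integrable B (EFin \o (cst `|M| : T -> R)).
    apply: (@bounded_integrable _ _ _ _ _ _ `|M|) => //.
    by move=> p _; rewrite /= normr_id.
  have ub r p : (`](-1), 1[%classic : set R) r -> B p ->
      `|partial1of2 g r p| <= (cst `|M| : T -> R) p.
    rewrite I => r11 Bp; rewrite partial1of2E.
    have [_ ->] := dg r p r11 Bp; have [_ /le_trans] := gM r p r11 Bp.
    by apply; exact: ler_norm.
  have It : (`](-1), 1[%classic : set R) t by rewrite I.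
  split.
    exact: (derivable_under_integral mB It intg dg1
      (fun=> normr_ge0 M) intM ub).
  rewrite (differentiation_under_integral mB It intg dg1
    (fun=> normr_ge0 M) intM ub).
  apply: eq_Rintegral => p /set_mem Bp; rewrite partial1of2E.
  by have [_ ->] := dg t p t11 Bp.
have near11 : \forall t \near (0 : R), -1 < t < 1.
  near=> t; apply/andP; split; near: t.
    by apply: lt_nbhsr; rewrite ltrN10.
  by apply: lt_nbhsl; rewrite ltr01.
have J1 t : -1 < t < 1 -> derivable J t 1 /\
    derive1 J t = \int[mu]_(p in B) f' t p.
  by move=> t11; apply: under => // r p r11 Bp; have [] := fM r p r11 Bp.
have [dJ' J''] : derivable (fun t => \int[mu]_(p in B) f' t p) 0 1 /\
    derive1 (fun t => \int[mu]_(p in B) f' t p) 0 = \int[mu]_(p in B) f'' 0 p.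
  apply: under => //; first by rewrite ltrN10 ltr01.
  by move=> r p r11 Bp; have [] := fM r p r11 Bp.
have eJ' : \forall t \near 0, \int[mu]_(p in B) f' t p = derive1 J t.
  by near=> t; symmetry; apply: (J1 t _).2; near: t.
split.
- by near=> t; apply: (J1 t _).1; near: t.
- exact: near_eq_derivable dJ'.
- rewrite derive1nS derive1n1 -J'' !derive1E; symmetry.
  exact: near_eq_derive.
Unshelve. all: by end_near. Qed.

(** * Open sets and continuous functions of the plane *)

(** The sigma-algebra of the plane is the product one, generated by rectangles;
    it contains the open sets because each of them is the countable union of
    the rectangles with rational vertices that it contains. *)
Lemma open_measurable_plane {R : realType}
    (A : set (measurableTypeR R * measurableTypeR R)) :
  open (A : set (R * R)) -> measurable A.
Proof.
move=> oA.
pose rect (q : rat * rat * rat * rat) : set (R * R) :=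
  `]ratr q.1.1.1, ratr q.1.1.2[%classic `*` `]ratr q.1.2, ratr q.2[%classic.
have -> : A = \bigcup_q (if `[< rect q `<=` A >] then rect q else set0).
  apply/seteqP; split => [p Ap|p [q _]]; last first.
    by case: ifP => // /asboolP; exact.
  have /nbhs_ballP[e /= e0 eA] : nbhs (p : R * R) A by exact: open_nbhs_nbhs.
  have /rat_in_itvoo[a /itvP a1] : p.1 - e < p.1 by rewrite ltrBlDr ltrDl.
  have /rat_in_itvoo[b /itvP b1] : p.1 < p.1 + e by rewrite ltrDl.
  have /rat_in_itvoo[c /itvP c2] : p.2 - e < p.2 by rewrite ltrBlDr ltrDl.
  have /rat_in_itvoo[k /itvP k2] : p.2 < p.2 + e by rewrite ltrDl.
  exists (a, b, c, k) => //; case: ifPn => [_|/asboolPn].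
    by split; rewrite /= in_itv /= ?a1 ?b1 ?c2 ?k2.
  case=> z [] /=; rewrite !in_itv /= => /andP[az zb] /andP[cz zk].
  apply: eA; split; rewrite /ball /= ltr_distlC.
    by rewrite (lt_trans _ az) ?a1 // (lt_trans zb) ?b1.
  by rewrite (lt_trans _ cz) ?c2 // (lt_trans zk) ?k2.
apply: countable_bigcupT_measurable => [|q]; first exact: countableP.
case: ifP => _; last exact: measurable0.
by apply: measurableX; exact: measurable_itv.
Qed.

Lemma continuous_measurable_plane {R : realType}
    (A : set (measurableTypeR R * measurableTypeR R))
    (f : measurableTypeR R * measurableTypeR R -> measurableTypeR R) :
  open (A : set (R * R)) ->
  (forall p : R * R, A p -> {for p, continuous (f : R * R -> R)}) ->
  measurable_fun A f.
Proof.
move=> oA cf mA.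
apply: (measurability _ (measurable_realfun.RGenOpens.measurableE R)) => //.
move=> _ [_ [a [b ->] <-]]; apply: open_measurable_plane.
have cA : {in (A : set (R * R)), continuous (f : R * R -> R)}.
  by move=> p /set_mem; exact: cf.
have [+ _] := @continuous_inP (R * R)%type R A f oA => /(_ cA).
by apply; exact: interval_open.
Qed.

Lemma area_lty {R : realType} (A : set (R * R)) (M : R) :
  measurable (A : set (measurableTypeR R * measurableTypeR R)) ->
  (forall p, A p -> `|p.1| <= M /\ `|p.2| <= M) ->
  (area R A < +oo)%E.
Proof.
move=> mA AM.
pose I : set (measurableTypeR R) := `[- M, M]%classic.
have mI : measurable I by exact: measurable_itv.
have AI : A `<=` I `*` I.
  by move=> p /AM[]; rewrite !ler_norml => p1 p2; split; rewrite /I /= in_itv.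
have lI : (lebesgue_measure I < +oo)%E.
  by rewrite lebesgue_measure_itv /=; case: ifP => _; rewrite -?EFinD ltry.
apply: (@le_lt_trans _ _ (area R (I `*` I))).
  by apply: le_measure => //; rewrite inE //; exact: measurableX.
rewrite /area product_measure1E //.
by rewrite lte_mul_pinfty // ge0_fin_numE.
Qed.

Lemma extends_to_closure_continuous {R : realType} (D : set (R * R))
    (f : R * R -> R) :
  open D -> extends_to_closure D f ->
  forall p, D p -> {for p, continuous f}.
Proof.
move=> oD [fbar [cf ff]] p Dp.
have nD : nbhs p D by exact: open_nbhs_nbhs.
have cfbar : {for p, continuous fbar}.
  have /continuous_subspaceW/(_ cf) : D `<=` closure D by exact: subset_closure.
  rewrite continuous_open_subspace //; apply; exact: mem_set.
rewrite /prop_for /continuous_at -(ff _ Dp); apply: cvg_trans cfbar.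
by apply: near_eq_cvg; near=> q; apply: ff; near: q.
Unshelve. all: by end_near. Qed.

(** A itself need not be closed, but its closure is a compact subset of
    closure D, on which the continuous extension is bounded. *)
Lemma extends_to_closure_bounded {R : realType} (D A : set (R * R))
    (f : R * R -> R) (M : R) :
  extends_to_closure D f -> A `<=` D ->
  (forall p, A p -> `|p.1| <= M /\ `|p.2| <= M) ->
  exists K, forall p, A p -> `|f p| <= K.
Proof.
move=> [fbar [cf ff]] AD AM.
have cQ : compact (`[- M, M]%classic `*` `[- M, M]%classic : set (R * R)).
  by apply: compact_setX; exact: segment_compact.
have cA : compact (closure A).
  apply: (subclosed_compact _ cQ); first exact: closed_closure.
  rewrite [X in _ `<=` X](_ : _ =
      closure (`[- M, M]%classic `*` `[- M, M]%classic)).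
    apply: closureS => p /AM[]; rewrite !ler_norml => p1 p2.
    by split; rewrite /= in_itv.
  apply/closure_id; apply: compact_closed cQ; exact: norm_hausdorff.
have /continuous_compact/(_ cA)/compact_bounded :
    {within closure A, continuous fbar}.
  by apply: continuous_subspaceW cf; exact: closureS.
(* bounded_set provides a bound only for the reals greater than K. *)
move=> [K [_ bK]]; exists (K + 1) => p Ap; rewrite -ff; last exact: AD.
apply: (bK (K + 1)); first by rewrite ltrDl.
by exists p => //; exact: subset_closure.
Qed.

(** * Families of continuous, uniformly bounded functions *)

(** The hypothesis under which t-dependent integrands can be handled on a
    bounded open set A: continuity in the point makes them measurable, and the
    bound, uniform in t, dominates them.  It is stable under the operations
    from which the integrand of H is built. *)
Definition tame {R : realType} (A : set (R * R)) (f : R -> R * R -> R) : Prop :=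
  (forall t p, -1 < t < 1 -> A p -> {for p, continuous (f t)}) /\
  exists M, forall t p, -1 < t < 1 -> A p -> `|f t p| <= M.

Section Tame.
Context {R : realType} (A : set (R * R)).
Implicit Types (f g w : R -> R * R -> R) (G : R * R -> R).

Lemma tameD f g : tame A f -> tame A g -> tame A (fun t p => f t p + g t p).
Proof.
move=> [cf [M fM]] [cg [N gN]]; split.
  by move=> t p t11 Ap; apply: continuousD; [exact: cf|exact: cg].
exists (M + N) => t p t11 Ap; apply: le_trans (ler_normD _ _) _.
by apply: lerD; [exact: fM|exact: gN].
Qed.

Lemma tameM f g : tame A f -> tame A g -> tame A (fun t p => f t p * g t p).
Proof.
move=> [cf [M fM]] [cg [N gN]]; split.
  by move=> t p t11 Ap; apply: continuousM; [exact: cf|exact: cg].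
exists (M * N) => t p t11 Ap; rewrite normrM.
by apply: ler_pM => //; [exact: fM|exact: gN].
Qed.

Lemma tame_time (a : R -> R) (M : R) :
  (forall t, -1 < t < 1 -> `|a t| <= M) -> tame A (fun t _ => a t).
Proof.
move=> aM; split; last by exists M => t p t11 _; exact: aM.
by move=> t p _ _; exact: cst_continuous.
Qed.

Lemma tame_cst (a : R) : tame A (fun _ _ => a).
Proof. exact: (@tame_time (fun=> a) `|a|). Qed.

Lemma tameN f : tame A f -> tame A (fun t p => - f t p).
Proof.
move=> tf; have := tameM (tame_cst (-1)) tf.
by congr tame; apply/funext => t; apply/funext => p; rewrite mulN1r.
Qed.

Lemma tame_affine f g :
  tame A f -> tame A g -> tame A (fun t p => f t p + t * g t p).
Proof.
move=> tf tg; apply: tameD => //; apply: tameM => //.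
apply: (@tame_time (fun t => t) 1) => t /andP[t0 t1].
by rewrite ler_norml !ltW.
Qed.

Section bounded_domain.
Variable M : R.
Hypothesis AM : forall p, A p -> `|p.1| <= M /\ `|p.2| <= M.

Lemma tame_snd : tame A (fun _ p => p.2).
Proof.
split; last by exists M => _ p _ /AM[].
by move=> _ p _ _; exact: cvg_snd.
Qed.

Lemma tame_extends (D : set (R * R)) G :
  open D -> A `<=` D -> extends_to_closure D G -> tame A (fun=> G).
Proof.
move=> oD AD eG; split.
  by move=> _ p _ /AD; exact: extends_to_closure_continuous.
have [K GK] := extends_to_closure_bounded eG AD AM.
by exists K => _ p _; exact: GK.
Qed.

(** The energy density is F (y, w) with w the vorticity at the point of height
    y.  The domain S of G is unbounded in w, but the values of w t stay in a
    bounded interval, so G is only evaluated on a bounded part of S. *)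
Lemma tame_comp (S : set (R * R)) G w :
  open S -> (forall p y, A p -> S (p.2, y)) -> extends_to_closure S G ->
  tame A w -> tame A (fun t p => G (p.2, w t p)).
Proof.
move=> oS AS eG [cw [N wN]]; split.
  move=> t p t11 Ap.
  have cp : {for p, continuous (fun q : R * R => (q.2, w t q))}.
    have cs : snd @ nbhs p --> nbhs p.2 by exact: cvg_snd.
    have cwp : w t @ nbhs p --> nbhs (w t p) by exact: cw.
    have := cvg_pair cs cwp.
    by apply.
  apply: (continuous_comp cp).
  by apply: (extends_to_closure_continuous oS eG); exact: AS.
pose B := S `&` [set q | `|q.1| <= Num.max M N /\ `|q.2| <= Num.max M N].
have [||K GK] := @extends_to_closure_bounded R S B G (Num.max M N) eG.
- by move=> q [].
- by move=> q [].
exists K => t p t11 Ap; apply: GK; split; first exact: AS.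
by rewrite /= !le_max (AM Ap).2 wN // orbT.
Qed.

End bounded_domain.
End Tame.

Lemma integral_tame_second_derivative {R : realType} (A : set (R * R))
    (M : R) (f f' f'' : R -> R * R -> R) :
  open A -> (forall p, A p -> `|p.1| <= M /\ `|p.2| <= M) ->
  tame A f -> tame A f' -> tame A f'' ->
  (forall (t : R) p, -1 < t < 1 -> A p -> is_derive t 1 (f ^~ p) (f' t p)) ->
  (forall (t : R) p, -1 < t < 1 -> A p -> is_derive t 1 (f' ^~ p) (f'' t p)) ->
  let J t := \int[area R]_(p in A) f t p in
  [/\ \forall t \near 0, derivable J t 1, derivable (derive1 J) 0 1 &
      derive1n 2 J 0 = \int[area R]_(p in A) f'' 0 p].
Proof.
move=> oA AM [cf [K fK]] [cf' [K' fK']] [_ [K'' fK'']] df df'.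
have mA := open_measurable_plane oA.
have mB t : -1 < t < 1 -> measurable_fun
    (A : set (measurableTypeR R * measurableTypeR R)) (f t).
  by move=> t11; apply: continuous_measurable_plane oA _ => p; exact: cf.
have mB' t : -1 < t < 1 -> measurable_fun
    (A : set (measurableTypeR R * measurableTypeR R)) (f' t).
  by move=> t11; apply: continuous_measurable_plane oA _ => p; exact: cf'.
have bA (t : R) p : -1 < t < 1 -> A p ->
    [/\ `|f t p| <= Num.max K (Num.max K' K''),
        `|f' t p| <= Num.max K (Num.max K' K'') &
        `|f'' t p| <= Num.max K (Num.max K' K'')].
  by move=> t11 Ap; rewrite !le_max fK // fK' // fK'' // !orbT.
exact: (second_derivative_under_integral mA (area_lty mA AM) mB mB' bA df df').
Qed.

(** * The integrand along a linear perturbation *)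

Lemma axis_x {R : realType} : axis (e_x : R * R).
Proof. by left. Qed.

Lemma axis_y {R : realType} : axis (e_y : R * R).
Proof. by right. Qed.

Lemma derive_affine {R : realType} (f g : R * R -> R) (t : R) (p v : R * R) :
  derivable f p v -> derivable g p v ->
  'D_v (fun p => f p + t * g p) p = 'D_v f p + t * 'D_v g p.
Proof.
move=> df dg; have dtg : derivable (t *: g) p v by exact: derivableZ.
by rewrite -[RHS](_ : 'D_v (f + t *: g) p = _) // deriveD // deriveZ.
Qed.

Section linear_perturbation.
Context {R : realType} (D : set (R * R)) (u h : R * R -> R).
Hypotheses (oD : open D) (Cu : C2_up_to_boundary D u)
  (Ch : C2_up_to_boundary D h).

Lemma derive_perturbation (t : R) (v p : R * R) : axis v -> D p ->
  'D_v (fun p => u p + t * h p) p = 'D_v u p + t * 'D_v h p.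
Proof.
case: Cu Ch => _ du _ [_ dh _] av Dp.
by rewrite derive_affine //; [exact: (du _ av).1|exact: (dh _ av).1].
Qed.

(** The first derivatives of u + t h are affine in t only in D; this is enough
    to differentiate once more since D is open. *)
Lemma derive2_perturbation (t : R) (v w p : R * R) :
  axis v -> axis w -> D p ->
  'D_w ('D_v (fun p => u p + t * h p)) p =
  'D_w ('D_v u) p + t * 'D_w ('D_v h) p.
Proof.
case: Cu Ch => _ _ du [_ _ dh] av aw Dp.
have nD : nbhs p D by exact: open_nbhs_nbhs.
rewrite -derive_affine; [|exact: (du _ _ av aw).1|exact: (dh _ _ av aw).1].
apply: near_eq_derive; near=> q; apply: derive_perturbation => //.
by near: q.
Unshelve. all: by end_near. Qed.

Lemma gradsq_perturbation (t : R) (p : R * R) : D p ->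
  gradsq (fun p => u p + t * h p) p =
  ('D_e_x u p + t * 'D_e_x h p) ^+ 2 + ('D_e_y u p + t * 'D_e_y h p) ^+ 2.
Proof.
move=> Dp; rewrite /gradsq.
by rewrite (derive_perturbation t axis_x Dp) (derive_perturbation t axis_y Dp).
Qed.

Lemma laplacian_perturbation (t : R) (p : R * R) : D p ->
  laplacian (fun p => u p + t * h p) p = laplacian u p + t * laplacian h p.
Proof.
move=> Dp; rewrite /laplacian (derive2_perturbation t axis_x axis_x Dp).
by rewrite (derive2_perturbation t axis_y axis_y Dp) mulrDr addrACA.
Qed.

End linear_perturbation.

Lemma is_derive_affine {R : realType} (a b t : R) :
  is_derive t (1 : R) (fun t => a + t * b) b.
Proof.
have := is_deriveD (is_derive_cst a t (1 : R))
  (is_deriveZ b (is_derive_id t (1 : R))).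
rewrite [0 + _](_ : _ = b); last by rewrite add0r; exact: mulr1.
by congr (is_derive _ _ _ _); apply/funext => r; congr (a + _); exact: mulrC.
Qed.

Lemma is_derive_half_square {R : realType} (a b t : R) :
  is_derive t (1 : R) (fun t => (a + t * b) ^+ 2 / 2) ((a + t * b) * b).
Proof.
have := is_deriveZ 2^-1 (is_deriveX 2 (is_derive_affine a b t)).
have -> : 2^-1 *: ((2%:R * (a + t * b) ^+ 2.-1) *: b) = (a + t * b) * b :> R.
  rewrite -[LHS]/(2^-1 * ((2%:R * (a + t * b) ^+ 1) * b)) expr1.
  by rewrite mulrA mulrA mulVf ?mul1r // pnatr_eq0.
by congr (is_derive _ _ _ _); apply/funext => r; exact: mulrC.
Qed.

Lemma is_derive_second_slot {R : realType} (G : R * R -> R) (y a b t : R) :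
  derivable G (y, a + t * b) e_y ->
  is_derive t (1 : R) (fun t => G (y, a + t * b))
    ('D_e_y G (y, a + t * b) * b).
Proof.
move=> dG.
(* Both functions have the same difference quotients. *)
have e : (fun h : R =>
    h^-1 *: (G (h *: e_y + (y, a + t * b)) - G (y, a + t * b))) =
  (fun h => h^-1 *: (G (y, h *: 1 + (a + t * b)) - G (y, a + t * b))).
  apply/funext => x; congr (_ *: (G _ - _)).
  rewrite /e_y /GRing.scale /= /GRing.add /= /add_pair /= /GRing.scale /=.
  by rewrite mulr0 add0r.
apply: (@is_derive1_comp R (fun w => G (y, w)) (fun t => a + t * b)).
  apply: DeriveDef; first by move: dG; rewrite /derivable /= e.
  by rewrite /derive /= e.
exact: is_derive_affine.
Qed.

(** * The second variation of the energy of one layer *)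

Definition layer_energy {R : realType} (A : set (R * R)) (F : R * R -> R)
    (r d q : R) (u : R * R -> R) : R :=
  \int[area R]_(p in A)
    (gradsq u p / 2 + r * (p.2 + d) - q - F (p.2, laplacian u p)).

(** The layer D lies between the graphs of lo and up, A is its period cell and
    S is the strip of the pairs (y, w) such that the height y occurs in D. *)
Section layer.
Context {R : realType} (lo up : R -> R).
Hypotheses (clo : continuous lo) (cup : continuous up).
Let D : set (R * R) := [set p | lo p.1 < p.2 < up p.1].
Let A : set (R * R) := [set p | - pi < p.1 < pi] `&` D.
Let S : set (R * R) := [set q | (snd @` D) q.1].

Lemma continuous_lt_open (T : topologicalType) (f g : T -> R) :
  continuous f -> continuous g -> open [set x | f x < g x].
Proof.
move=> cf cg.
have -> : [set x | f x < g x] = (fun x => g x - f x) @^-1` [set r | 0 < r].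
  by apply/seteqP; split => x /=; rewrite subr_gt0.
apply: open_comp; last exact: open_gt.
by move=> x _; apply: continuousB; [exact: cg|exact: cf].
Qed.

Lemma graph_layer_open : open D.
Proof.
rewrite (_ : D = [set p : R * R | lo p.1 < p.2] `&` [set p | p.2 < up p.1]).
  apply: openI; apply: continuous_lt_open => p; try exact: cvg_snd.
    by apply: continuous_comp; [exact: cvg_fst|exact: clo].
  by apply: continuous_comp; [exact: cvg_fst|exact: cup].
by apply/seteqP; split => p /=; rewrite /D /=; [move/andP|move=> [-> ->]].
Qed.

Lemma period_cell_open : open A.
Proof.
apply: openI graph_layer_open.
rewrite (_ : [set p | _] = [set p : R * R | - pi < p.1] `&` [set p | p.1 < pi]).
  by apply: openI; apply: continuous_lt_open => p;
    try exact: cvg_fst; exact: cst_continuous.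
by apply/seteqP; split => p /=; [move/andP|move=> [-> ->]].
Qed.

Lemma height_strip_open : open S.
Proof.
rewrite openE => q /= [p Dp pq].
have nD : nbhs p D by exact: open_nbhs_nbhs (conj graph_layer_open Dp).
have /nbhs_ballP[e /= e0 eD] := nD.
apply/nbhs_ballP; exists e => //= z [z1 _].
exists (p.1, z.1) => //; apply: eD; split; first exact: ballxx.
by rewrite /= pq.
Qed.

Lemma period_cell_bounded :
  exists M, forall p, A p -> `|p.1| <= M /\ `|p.2| <= M.
Proof.
have bd (f : R -> R) : continuous f ->
    exists M, forall x, - pi < x < pi -> `|f x| <= M.
  move=> cf.
  have wf : {within `[- pi, pi]%classic, continuous f}.
    exact: continuous_subspaceT.
  have [M [_ bM]] :=
    compact_bounded (continuous_compact wf (@segment_compact _ _ _)).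
  exists (M + 1) => x /andP[x1 x2]; apply: (bM (M + 1)); first by rewrite ltrDl.
  by exists x => //; rewrite /= in_itv /= !ltW.
have [M loM] := bd _ clo; have [N upN] := bd _ cup.
exists (Num.max pi (Num.max M N)) => p [p1 /andP[lop pup]]; split.
  rewrite le_max ler_norml.
  by case/andP: p1 => p1 p1'; rewrite (ltW p1) (ltW p1').
have /ler_normlP[loM1 _] := loM _ p1; have /ler_normlP[_ upN1] := upN _ p1.
rewrite !le_max; have [p0|p0] := leP 0 p.2.
  by rewrite (ger0_norm p0) (le_trans (ltW pup) upN1) !orbT.
have pM : - p.2 <= M by apply: le_trans loM1; rewrite lerN2 ltW.
by rewrite (ltr0_norm p0) pM !orbT.
Qed.

Variables (u h F : R * R -> R).
Hypotheses (Cu : C2_up_to_boundary D u) (Ch : C2_up_to_boundary D h).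
Hypotheses (CF : C2_up_to_boundary S F).

(** The second derivative at 0 is the integral of
    |grad h|^2 - F_22 (y, Delta u) (Delta h)^2.  Only the sign of F_22 at the
    unperturbed vorticity enters, since t = 0 there; for t <> 0 boundedness of
    F_22 is enough. *)
Lemma layer_second_variation_ge0 (r d q : R) :
  (forall p, A p -> 'D_e_y ('D_e_y F) (p.2, laplacian u p) < 0) ->
  let J t := layer_energy A F r d q (fun p => u p + t * h p) in
  [/\ \forall t \near 0, derivable J t 1, derivable (derive1 J) 0 1 &
      0 <= derive1n 2 J 0].
Proof.
move=> Fneg.
have oD := graph_layer_open; have oA := period_cell_open.
have oS := height_strip_open; have [M AM] := period_cell_bounded.
have AD p : A p -> D p by case.
have AS p y : A p -> S (p.2, y) by move=> Ap; exists p => //; exact: AD.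
pose w t p := laplacian u p + t * laplacian h p.
pose ux t p := 'D_e_x u p + t * 'D_e_x h p.
pose uy t p := 'D_e_y u p + t * 'D_e_y h p.
pose f t p := ux t p ^+ 2 / 2 + uy t p ^+ 2 / 2 + (r * (p.2 + d) - q)
  - F (p.2, w t p).
pose f' t p := ux t p * 'D_e_x h p + uy t p * 'D_e_y h p
  - 'D_e_y F (p.2, w t p) * laplacian h p.
pose f'' (t : R) p := 'D_e_x h p * 'D_e_x h p + 'D_e_y h p * 'D_e_y h p
  - ('D_e_y ('D_e_y F) (p.2, w t p) * laplacian h p) * laplacian h p.
have tame1 v k : axis v -> C2_up_to_boundary D k -> tame A (fun=> 'D_v k).
  by move=> av [_ dk _]; exact: (tame_extends AM oD AD (dk _ av).2).
have tamelap k : C2_up_to_boundary D k -> tame A (fun=> laplacian k).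
  case=> _ _ dk; apply: tameD.
    exact: (tame_extends AM oD AD (dk _ _ axis_x axis_x).2).
  exact: (tame_extends AM oD AD (dk _ _ axis_y axis_y).2).
have tw : tame A w by apply: tame_affine; exact: tamelap.
have thx := tame1 _ _ axis_x Ch; have thy := tame1 _ _ axis_y Ch.
have tux : tame A ux := tame_affine (tame1 _ _ axis_x Cu) thx.
have tuy : tame A uy := tame_affine (tame1 _ _ axis_y Cu) thy.
have eF : extends_to_closure S F by exists F; case: CF.
have [_ /(_ _ axis_y)[dF eF'] /(_ _ _ axis_y axis_y)[dF' eF'']] := CF.
have tsq g : tame A g -> tame A (fun t p => g t p ^+ 2 / 2).
  by move=> tg; apply: tameM; [exact: tameM|exact: tame_cst].
have tf : tame A f.
  apply: tameD; last exact/tameN/(tame_comp AM oS AS eF tw).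
  apply: tameD; first by apply: tameD; exact: tsq.
  apply: tameD; last exact: tame_cst.
  apply: tameM; first exact: tame_cst.
  by apply: tameD; [exact: (tame_snd AM)|exact: tame_cst].
have tf' : tame A f'.
  apply: (tameD (tameD (tameM tux thx) (tameM tuy thy))).
  apply: tameN; apply: tameM; last exact: tamelap.
  exact: (tame_comp AM oS AS eF' tw).
have tf'' : tame A f''.
  apply: (tameD (tameD (tameM thx thx) (tameM thy thy))).
  apply: tameN; apply: tameM; last exact: tamelap.
  apply: tameM; last exact: tamelap.
  exact: (tame_comp AM oS AS eF'' tw).
have df (t : R) p : -1 < t < 1 -> A p -> is_derive t (1 : R) (f ^~ p) (f' t p).
  move=> _ Ap.
  have dF1 := is_derive_second_slot (dF _ (AS p (w t p) Ap)).
  have d0 := is_deriveD (is_deriveD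
    (is_derive_half_square ('D_e_x u p) ('D_e_x h p) t)
    (is_derive_half_square ('D_e_y u p) ('D_e_y h p) t))
    (is_derive_cst (r * (p.2 + d) - q) t (1 : R)).
  have := is_deriveB d0 dF1.
  by rewrite addr0.
have df' (t : R) p : -1 < t < 1 -> A p ->
    is_derive t (1 : R) (f' ^~ p) (f'' t p).
  move=> _ Ap.
  have dF1 := is_derive_second_slot (dF' _ (AS p (w t p) Ap)).
  have dm (g : R -> R) (a b : R) : is_derive t (1 : R) g a ->
      is_derive t (1 : R) (fun t => g t * b) (a * b).
    move=> dg; have := is_deriveZ b dg; rewrite [b *: a](_ : _ = a * b).
      by congr (is_derive _ _ _ _); apply/funext => x; exact: mulrC.
    exact: mulrC.
  exact: (is_deriveB (is_deriveD
    (dm _ _ ('D_e_x h p) (is_derive_affine ('D_e_x u p) ('D_e_x h p) t))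
    (dm _ _ ('D_e_y h p) (is_derive_affine ('D_e_y u p) ('D_e_y h p) t)))
    (dm _ _ (laplacian h p) dF1)).
move=> J; have -> : J = (fun t => \int[area R]_(p in A) f t p).
  apply/funext => t; apply: eq_Rintegral => p /set_mem Ap.
  have Dp := AD _ Ap.
  rewrite (gradsq_perturbation Cu Ch t Dp).
  by rewrite (laplacian_perturbation oD Cu Ch t Dp) /f mulrDl addrA.
have [dJ dJ' J''] := integral_tame_second_derivative oA AM tf tf' tf'' df df'.
split=> //; rewrite J''; apply: Rintegral_ge0 => p Ap.
rewrite /f'' /w mul0r addr0 -mulrA subr_ge0.
apply: (@le_trans _ _ 0).
  by apply: mulr_le0_ge0; [exact: ltW (Fneg _ Ap)|rewrite -expr2 sqr_ge0].
by apply: addr_ge0; rewrite -expr2 sqr_ge0.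
Qed.

End layer.

(** * Assembling the two layers *)

Lemma Ck2_continuous {R : realType} (f : R -> R) : Ck 2 f -> continuous f.
Proof.
move=> [df _] x; apply/differentiable_continuous/derivable1_diffP.
exact: (df 0%N x).
Qed.

Lemma second_derivative_sum_ge0 {R : realType} (J1 J2 : R -> R) :
  [/\ \forall t \near 0, derivable J1 t 1, derivable (derive1 J1) 0 1 &
      0 <= derive1n 2 J1 0] ->
  [/\ \forall t \near 0, derivable J2 t 1, derivable (derive1 J2) 0 1 &
      0 <= derive1n 2 J2 0] ->
  [/\ \forall t \near 0, derivable (J1 + J2) t 1,
      derivable (derive1 (J1 + J2)) 0 1 & 0 <= derive1n 2 (J1 + J2) 0].
Proof.
move=> [dJ1 ddJ1 J1_ge0] [dJ2 ddJ2 J2_ge0].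
have e1 : \forall t \near 0, (derive1 J1 + derive1 J2) t = derive1 (J1 + J2) t.
  apply: filterS2 dJ1 dJ2 => t d1 d2.
  by rewrite (derive1E (J1 + J2)) (deriveD d1 d2) -!derive1E.
split.
- by apply: filterS2 dJ1 dJ2 => t d1 d2; exact: derivableD.
- exact: near_eq_derivable e1 (derivableD ddJ1 ddJ2).
- have J''E : derive1n 2 (J1 + J2) 0 = derive1n 2 J1 0 + derive1n 2 J2 0.
    rewrite -[LHS]/(derive1 (derive1 (J1 + J2)) 0) (derive1E (derive1 _)).
    by rewrite -(near_eq_derive _ e1) (deriveD ddJ1 ddJ2) -!derive1E.
  rewrite J''E; exact: addr_ge0 J1_ge0 J2_ge0.
Qed.

Theorem theorem4p3 (R : realType) (c : setting R) (F1 F2 : R * R -> R)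
    (s : state R)
    (hc : admissible_setting c)
    (hs : travelling_wave c s)
    (hF1 : is_F (grav c) (rho1 c) (beta1 c) (layer1 (depth c) s) F1)
    (hF2 : is_F (grav c) (rho2 c) (beta2 c) (layer2 s) F2)
    (neg1 : forall p, Omega1 (depth c) s p ->
      'D_e_y ('D_e_y F1) (p.2, laplacian (Psi1 s) p) < 0)
    (neg2 : forall p, Omega2 s p ->
      'D_e_y ('D_e_y F2) (p.2, laplacian (Psi2 s) p) < 0) :
  linearly_stable (H c F1 F2) s (fixed_boundary_perturbations (depth c) s).
Proof.
move=> h [[Ch1 Ch2 _ _ _] eta0 etat0].
have [Cu1 Cu2 _ [Ceta _] [Cetat _]] := tw_regular hs.
have ceta := Ck2_continuous Ceta; have cetat := Ck2_continuous Cetat.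
have cbed : continuous (fun _ : R => - depth c : R).
  by move=> x; exact: cst_continuous.
have [CF1 _ _] := hF1; have [CF2 _ _] := hF2.
have [dJ1 ddJ1 J1_ge0] := layer_second_variation_ge0
  cbed cetat Cu1 Ch1 CF1
  (grav c * rho1 c (p1 c)) (depth c) (Q1 c + Q2 c) neg1.
have [dJ2 ddJ2 J2_ge0] := layer_second_variation_ge0
  cetat ceta Cu2 Ch2 CF2 (grav c * rho2 c 0) (depth c) (Q2 c) neg2.
pose J1 t := layer_energy (Omega1 (depth c) s) F1 (grav c * rho1 c (p1 c))
  (depth c) (Q1 c + Q2 c) (fun p => Psi1 s p + t * Psi1 h p).
pose J2 t := layer_energy (Omega2 s) F2 (grav c * rho2 c 0)
  (depth c) (Q2 c) (fun p => Psi2 s p + t * Psi2 h p).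
have HE : (fun t => H c F1 F2 (perturb s h t)) = J1 + J2.
  apply/funext => t.
  have eE : (fun x => eta s x + t * eta h x) = eta s.
    by apply/funext => x; rewrite eta0 mulr0 addr0.
  have etE : (fun x => etat s x + t * etat h x) = etat s.
    by apply/funext => x; rewrite etat0 mulr0 addr0.
  by rewrite /perturb eE etE.
rewrite /has_second_variation /second_variation HE.
have [dJ ddJ J_ge0] := second_derivative_sum_ge0 (And3 dJ1 ddJ1 J1_ge0)
  (And3 dJ2 ddJ2 J2_ge0).
by [].
Qed.
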